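(* Let $r$ have the improper hyper-prior density $f(r)\propto 1/r$ on $(0,\infty)$ and, independently, let $\boldsymbol\beta$ have a hyper-prior density $g$ on $\mathbf R^m$ that is either improper flat, $g(\boldsymbol\beta)\propto 1$, or a proper multivariate Gaussian density. Then, regardless of the data $\boldsymbol y$, the joint posterior density $\pi_{\mathrm{hyp.post}}(r,\boldsymbol\beta\mid\boldsymbol y)\propto f(r)\,g(\boldsymbol\beta)\,L(r,\boldsymbol\beta)$ is improper.
   Context: Beta-Binomial-Logit model. There are $k\ge 1$ groups; group $j$ has an integer number of trials $n_j\ge 1$, an observed number of successes $y_j\in\{0,1,\dots,n_j\}$, and a fixed covariate vector $\boldsymbol x_j\in\mathbf R^m$, with $k\ge m\ge 1$. Put $\boldsymbol y=(y_1,\dots,y_k)^\top$. The hyper-parameters are $r\in(0,\infty)$ and $\boldsymbol\beta\in\mathbf R^m$. Write $$p^E_j=p^E_j(\boldsymbol\beta)=\frac{\exp(\boldsymbol x_j^\top\boldsymbol\beta)}{1+\exp(\boldsymbol x_j^\top\boldsymbol\beta)},\qquad q^E_j=1-p^E_j .$$ The likelihood function (a product of Beta-Binomial probability mass functions) is $$L(r,\boldsymbol\beta)=\prod_{j=1}^k\binom{n_j}{y_j}\frac{B(y_j+rp^E_j,\;n_j-y_j+rq^E_j)}{B(rp^E_j,\;rq^E_j)},$$ where $B(a,b)=\int_0^1 v^{a-1}(1-v)^{b-1}\,dv$ for $a,b>0$ is the beta function. The posterior $\pi_{\mathrm{hyp.post}}(r,\boldsymbol\beta\mid\boldsymbol y)\propto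 f(r)g(\boldsymbol\beta)L(r,\boldsymbol\beta)$ is called proper if $\int_{\mathbf R^m}\int_0^\infty f(r)g(\boldsymbol\beta)L(r,\boldsymbol\beta)\,dr\,d\boldsymbol\beta<\infty$ and improper if this integral is infinite. *)

(* Defs.v *)
From HB Require Import structures.
From mathcomp Require Import all_boot all_order all_algebra.
From mathcomp Require Import all_classical all_reals all_analysis.

Set Implicit Arguments.
Unset Strict Implicit.
Unset Printing Implicit Defensive.

Import Order.TTheory GRing.Theory Num.Theory.
Import numFieldNormedType.Exports.

Local Open Scope classical_set_scope.
Local Open Scope ring_scope.

Definition tuple_cons (R : realType) (n : nat)
    (xt : measurableTypeR R * n.-tuple (measurableTypeR R)) :
    n.+1.-tuple (measurableTypeR R) :=
  [tuple of xt.1 :: xt.2].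

(* The m-dimensional Lebesgue measure, on the library's product sigma-algebra
   of m-tuples. It is a sigma-finite measure (instances below), with the
   expected values on boxes (lebesgue_tuple_box). *)
Fixpoint lebesgue_tuple (R : realType) (m : nat) :
    set (m.-tuple (measurableTypeR R)) -> \bar R :=
  match m return set (m.-tuple (measurableTypeR R)) -> \bar R with
  | 0 => \d_([tuple] : 0.-tuple (measurableTypeR R))
  | n.+1 => pushforward (@lebesgue_measure R \x @lebesgue_tuple R n)%E
                        (@tuple_cons R n)
  end.
Arguments lebesgue_tuple : clear implicits.

Lemma measurable_tuple_cons (R : realType) n :
  measurable_fun setT (@tuple_cons R n).
Proof. exact: measurable_cons. Qed.

Lemma product_measure1_sigma_finite d1 d2 (T1 : measurableType d1)
    (T2 : measurableType d2) (R : realType)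
    (m1 : {sigma_finite_measure set T1 -> \bar R})
    (m2 : {sigma_finite_measure set T2 -> \bar R}) :
  sigma_finite setT (m1 \x m2)%E.
Proof.
have /sigma_finiteP[F [TF ndF Foo]] := sigma_finiteT m1.
have /sigma_finiteP[G [TG ndG Goo]] := sigma_finiteT m2.
exists (fun n => F n `*` G n).
  rewrite -setXTT TF TG predeqE => -[x y]; split.
    move=> [/= [n _ Fnx] [k _ Gky]]; exists (maxn n k) => //; split.
    - by move: x Fnx; exact/subsetPset/ndF/leq_maxl.
    - by move: y Gky; exact/subsetPset/ndG/leq_maxr.
  by move=> [n _ []/= ? ?]; split; exists n.
move=> k; have [? ?] := Foo k; have [? ?] := Goo k.
split; first exact: measurableX.
by rewrite product_measure1E// lte_mul_pinfty// ge0_fin_numE.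
Qed.

Section lebesgue_tuple_step.
Variables (R : realType) (n : nat).
Local Notation RR := (measurableTypeR R).
Variable mu : {sigma_finite_measure set (n.-tuple RR) -> \bar R}.

Let nu := pushforward (@lebesgue_measure R \x mu)%E (@tuple_cons R n).

Let nu0 : nu set0 = 0%E.
Proof. by rewrite /nu /pushforward preimage_set0 measure0. Qed.

Let nu_ge0 A : (0 <= nu A)%E.
Proof. by rewrite /nu /pushforward. Qed.

Let nu_sigma_additive : semi_sigma_additive nu.
Proof.
move=> F mF tF mUF; rewrite /nu /pushforward preimage_bigcup.
have mpre A : measurable A -> measurable (@tuple_cons R n @^-1` A).
  move=> mA; rewrite -[X in measurable X]setTI.
  exact: measurable_tuple_cons.
apply: measure_semi_sigma_additive.
- by move=> i; exact: mpre.
- apply/trivIsetP => /= i j _ _ ij; rewrite -preimage_setI.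
  by move/trivIsetP : tF => /(_ _ _ _ _ ij) ->//; rewrite preimage_set0.
- by rewrite -preimage_bigcup; exact: mpre.
Qed.

HB.instance Definition _ :=
  isMeasure.Build _ _ _ nu nu0 nu_ge0 nu_sigma_additive.

Let nu_sigma_finite : sigma_finite setT nu.
Proof.
have [F FT Foo] := product_measure1_sigma_finite (@lebesgue_measure R) mu.
pose u (t : n.+1.-tuple RR) : RR * n.-tuple RR := (thead t, [tuple of behead t]).
have uK xt : u (tuple_cons xt) = xt.
  by case: xt => a t; congr pair; apply: val_inj.
have mu_ : measurable_fun setT u.
  apply: measurable_fun_pair; last exact: measurable_behead.
  exact: measurable_tnth.
exists (fun k => u @^-1` F k).
  by rewrite -preimage_bigcup -FT preimage_setT.
move=> k; have [mFk Fkoo] := Foo k; split.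
  by rewrite -[X in measurable X]setTI; exact: mu_.
rewrite /nu /pushforward -comp_preimage (_ : u \o _ = id) //.
by apply/funext => xt /=; exact: uK.
Qed.

HB.instance Definition _ :=
  Measure_isSigmaFinite.Build _ _ _ nu nu_sigma_finite.

Lemma lebesgue_tuple_step :
  exists nu' : {sigma_finite_measure set (n.+1.-tuple RR) -> \bar R},
    pushforward (@lebesgue_measure R \x mu)%E (@tuple_cons R n) = nu'.
Proof. by exists nu. Qed.

End lebesgue_tuple_step.

Lemma lebesgue_tuple_sigma_finite_measure (R : realType) m :
  exists mu : {sigma_finite_measure set (m.-tuple (measurableTypeR R)) -> \bar R},
    lebesgue_tuple R m = mu.
Proof.
elim: m => [|n [mu muE]]; first by exists (\d_[tuple]).
by have [nu nuE] := lebesgue_tuple_step mu; exists nu; rewrite -nuE /= muE.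
Qed.

Section lebesgue_tuple_instances.
Variables (R : realType) (m : nat).

Let lebesgue_tuple0 : lebesgue_tuple R m set0 = 0%E.
Proof.
by have [mu ->] := lebesgue_tuple_sigma_finite_measure R m; rewrite measure0.
Qed.

Let lebesgue_tuple_ge0 A : (0 <= lebesgue_tuple R m A)%E.
Proof. by have [mu ->] := lebesgue_tuple_sigma_finite_measure R m. Qed.

Let lebesgue_tuple_sigma_additive : semi_sigma_additive (lebesgue_tuple R m).
Proof.
have [mu ->] := lebesgue_tuple_sigma_finite_measure R m.
exact: measure_semi_sigma_additive.
Qed.

HB.instance Definition _ := isMeasure.Build _ _ _ (lebesgue_tuple R m)
  lebesgue_tuple0 lebesgue_tuple_ge0 lebesgue_tuple_sigma_additive.

Let lebesgue_tuple_sigma_finite : sigma_finite setT (lebesgue_tuple R m).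
Proof.
have [mu ->] := lebesgue_tuple_sigma_finite_measure R m.
exact: sigma_finiteT.
Qed.

HB.instance Definition _ := Measure_isSigmaFinite.Build _ _ _
  (lebesgue_tuple R m) lebesgue_tuple_sigma_finite.

End lebesgue_tuple_instances.

Lemma measurable_box (R : realType) n (A : 'I_n -> set (measurableTypeR R)) :
  (forall i, measurable (A i)) ->
  measurable ([set t | forall i, A i (tnth t i)]
              : set (n.-tuple (measurableTypeR R))).
Proof.
move=> mA.
rewrite (_ : [set t | _] =
    \bigcap_(i in setT) ((@tnth n (measurableTypeR R) ^~ i) @^-1` A i)).
  apply: fin_bigcap_measurable => // i _.
  by rewrite -[X in measurable X]setTI; exact: measurable_tnth.
by apply/seteqP; split => t /= H i; [move=> _|]; exact: H.
Qed.

Lemma lebesgue_tuple_box (R : realType) m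
    (A : 'I_m -> set (measurableTypeR R)) : (forall i, measurable (A i)) ->
  lebesgue_tuple R m [set t | forall i, A i (tnth t i)] =
  (\prod_(i < m) lebesgue_measure (A i))%E.
Proof.
elim: m A => [|n IH] A mA.
  by rewrite big_ord0 /= diracE mem_set // => -[].
rewrite big_ord_recl /= /pushforward.
rewrite (_ : _ @^-1` _ =
    A ord0 `*` [set t | forall i, A (lift ord0 i) (tnth t i)]).
  rewrite product_measure1E //=; last first.
    by apply: (@measurable_box R n (fun i => A (lift ord0 i))) => i; exact: mA.
  by rewrite (IH (fun i => A (lift ord0 i))) // => i; exact: mA.
apply/seteqP; split => -[a t] /=.
  move=> H; split; first exact: (H ord0).
  by move=> i; have := H (lift ord0 i); rewrite tnthS.
move=> [a0 H] i; case: (unliftP ord0 i) => [j ->|->//].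
by rewrite tnthS; exact: H.
Qed.

(* B(a, b); meaningful for a, b > 0. *)
Definition beta_real (R : realType) (a b : R) : R :=
  \int[@lebesgue_measure R]_(v in `]0, 1[) (v `^ (a - 1) * (1 - v) `^ (b - 1)).

Section beta_binomial_logit.
Variables (R : realType) (k m : nat).

Definition success_prob (x beta : 'cV[R]_m) : R :=
  let t := (x^T *m beta) ord0 ord0 in expR t / (1 + expR t).

Definition likelihood (n y : 'I_k -> nat) (x : 'I_k -> 'cV[R]_m)
    (r : R) (beta : 'cV[R]_m) : R :=
  \prod_(j < k)
    let p := success_prob (x j) beta in
    let q := 1 - p in
    'C(n j, y j)%:R *
    (beta_real ((y j)%:R + r * p) ((n j)%:R - (y j)%:R + r * q) /
     beta_real (r * p) (r * q)).

(* The integrand is nonnegative for nonnegative f and g, so this iterated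
   integral always makes sense in [0, +oo]. Points of R^m are integrated over
   as m-tuples and read as column vectors. *)
Definition posterior_mass (f : R -> R) (g : 'cV[R]_m -> R)
    (n y : 'I_k -> nat) (x : 'I_k -> 'cV[R]_m) : \bar R :=
  (\int[lebesgue_tuple R m]_b
   \int[@lebesgue_measure R]_(r in `]0%R, +oo[)
     let beta : 'cV[R]_m := \col_i tnth b i in
     (f r * g beta * likelihood n y x r beta)%:E)%E.

Definition proper_posterior f g n y x : Prop :=
  (posterior_mass f g n y x < +oo)%E.

Definition improper_posterior f g n y x : Prop :=
  posterior_mass f g n y x = +oo%E.

End beta_binomial_logit.

Definition proportional_on (R : realType) (T : Type) (D : set T)
    (f h : T -> R) : Prop :=
  exists2 c : R, 0 < c & forall t, D t -> f t = c * h t.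

Definition positive_definite (R : realType) (m : nat) (S : 'M[R]_m) : Prop :=
  S^T = S /\
  forall v : 'cV[R]_m, v != 0 -> 0 < (v^T *m S *m v) ord0 ord0.

(* Density of the normal law N(mu, S) with respect to Lebesgue measure. *)
Definition gaussian_density (R : realType) (m : nat) (mu : 'cV[R]_m)
    (S : 'M[R]_m) (b : 'cV[R]_m) : R :=
  (Num.sqrt ((2 * pi) ^+ m * \det S))^-1 *
  expR (- (((b - mu)^T *m invmx S *m (b - mu)) ord0 ord0) / 2).

Definition is_gaussian_density (R : realType) (m : nat)
    (g : 'cV[R]_m -> R) : Prop :=
  exists mu S, positive_definite S /\ g = gaussian_density mu S.

(* Main.v *)
(* As r tends to infinity the Beta-Binomial likelihood tends to a positive
   Binomial one, so for every beta it is bounded below by a positive constant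
   on some [r0, +oo[. There the integrand dominates a positive multiple of
   1 / r, so the inner integral is +oo for every beta. The lower bound follows
   from B(a + 1, b) = a / (a + b) B(a, b) and its mirror image; only a, b > 1
   is needed, where the integrand of B extends continuously to [0, 1]. *)

Require Import Defs.
From mathcomp Require Import all_boot all_order all_algebra.
From mathcomp Require Import all_classical all_reals all_analysis.
From mathcomp Require Import ring lra.

Set Implicit Arguments.
Unset Strict Implicit.
Unset Printing Implicit Defensive.

Import Order.TTheory GRing.Theory Num.Theory.
Import numFieldNormedType.Exports.

Local Open Scope classical_set_scope.
Local Open Scope ring_scope.

(** * Comparison of integrals and positivity of Lebesgue measure *)

(** Both integrals are suprema over simple functions, and one lying below [f] extended by 0 outside
    [A] also lies below [g] extended by 0 outside [B]. In this form it applies directly to the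
    likelihood as a function of [r]. *)
Lemma ge0_le_integral_subset d (T : measurableType d) (R : realType)
    (mu : {measure set T -> \bar R}) (A B : set T) (f g : T -> \bar R) :
  A `<=` B -> (forall t, A t -> (0 <= f t)%E) ->
  (forall t, B t -> (0 <= g t)%E) -> (forall t, A t -> (f t <= g t)%E) ->
  (\int[mu]_(t in A) f t <= \int[mu]_(t in B) g t)%E.
Proof.
move=> AB f0 g0 fg; rewrite !ge0_integralE //=; apply: le_ereal_sup => _ [h hf <-].
exists h => //= t; apply: (le_trans (hf t)); rewrite !patchE.
case: ifPn => [|_]; first by rewrite inE => At; rewrite mem_set ?fg//; exact: AB.
by case: ifPn => //; rewrite inE => /g0.
Qed.

(** The unit cube already has measure 1. Positivity makes the integral of the constant [+oo]
    infinite. *)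
Lemma lebesgue_tuple_setT_gt0 (R : realType) (m : nat) :
  (0 < lebesgue_tuple R m setT)%E.
Proof.
pose I : set (measurableTypeR R) := `[0%R, 1%R]%classic.
have mI : measurable I by exact: measurable_itv.
have := @lebesgue_tuple_box R m (fun=> I) (fun=> mI).
rewrite big1 => [box|i _]; last by rewrite lebesgue_measure_itv/= lte01 oppr0 adde0.
apply: (@lt_le_trans _ _ 1%E) => //; rewrite -box le_measure ?inE//.
exact: (@measurable_box R m (fun=> I) (fun=> mI)).
Qed.

(** * Positivity of the Gaussian density; range of the success probabilities *)

Lemma posdef_det_gt0 (R : realType) (m : nat) (S : 'M[R]_m) :
  positive_definite S -> 0 < \det S.
Proof.
move=> [_ Spos]; rewrite ltNge; apply/negP => detS.
(* On the segment from 1 to S the determinant starts at 1 and, by positive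
   definiteness, never vanishes. *)
pose p : {poly R} := \det (map_mx polyC 1%:M + 'X *: map_mx polyC (S - 1%:M)).
have pE t : p.[t] = \det (1%:M + t *: (S - 1%:M)).
  rewrite -horner_evalE -det_map_mx; congr (\det _); apply/matrixP => i j.
  by rewrite !mxE /= /horner_eval !hornerE.
have [||t /andP[t0 t1]] := @Num.poly_ivt R (- p) 0 1 _ _.
- exact: ler01.
- rewrite !hornerN !pE scale0r addr0 det1 scale1r addrC subrK oppr_le0 oppr_ge0.
  by rewrite ler01.
rewrite rootN /root pE => /det0P[v v0 vM].
have vt0 : v^T != 0 by rewrite trmx_eq0.
have vv0 : 0 < (v *m v^T) ord0 ord0.
  rewrite mxE; have [i vi] : exists i, v 0 i != 0 by apply/rV0Pn.
  rewrite (bigD1 i)//= mxE ltr_pwDl//.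
    by rewrite -expr2 exprn_even_gt0.
  by apply: sumr_ge0 => j _; rewrite mxE -expr2 sqr_ge0.
have := Spos _ vt0; rewrite trmxK => vSv.
have : (v *m (1%:M + t *: (S - 1%:M)) *m v^T) ord0 ord0 = 0.
  by rewrite vM mul0mx mxE.
(* The equation becomes [(1 - t) * A + t * B = 0] with [A, B > 0] and [0 <= t <= 1], which is
   absurd. *)
rewrite mulmxDr mulmx1 -scalemxAr mulmxBr mulmx1 mulmxDl -scalemxAl mulmxBl.
move: (v *m v^T) (v *m S *m v^T) vv0 vSv => A B A0 B0; rewrite !mxE => e.
nra.
Qed.

Lemma gaussian_density_gt0 (R : realType) (m : nat) (g : 'cV[R]_m -> R) b :
  is_gaussian_density g -> 0 < g b.
Proof.
move=> [mu [S [Spd ->]]]; rewrite /gaussian_density mulr_gt0 ?expR_gt0//.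
rewrite invr_gt0 sqrtr_gt0 mulr_gt0 ?posdef_det_gt0// exprn_gt0//.
by rewrite mulr_gt0 ?pi_gt0.
Qed.

Lemma success_prob_itv (R : realType) (m : nat) (x b : 'cV[R]_m) :
  0 < success_prob x b < 1.
Proof.
rewrite /success_prob; set t := expR _; have t0 : 0 < t by exact: expR_gt0.
have t10 : 0 < 1 + t by lra.
by rewrite divr_gt0//= ltr_pdivrMr// mul1r ltrDr.
Qed.

(** * Divergence of the integral of [c / r] at infinity *)

Lemma integral_inv_pinfty (R : realType) (a c : R) : 0 < a -> 0 < c ->
  (\int[@lebesgue_measure R]_(r in `[a, +oo[) (c / r)%:E = +oo)%E.
Proof.
move=> a0 c0; apply/eqyP => A A0.
(* Chosen so that the integral over [[a, b]], namely [c * ln b - c * ln a], equals [A]. *)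
pose b := a * expR (A / c).
have ab : a < b by rewrite /b ltr_pMr// expR_gt1 divr_gt0.
have -> : A = c * ln b - c * ln a.
  by rewrite /b lnM ?posrE ?expR_gt0// expRK; field; rewrite gt_eqF.
rewrite EFinB -(@continuous_FTC2 _ (fun r => c / r) (fun r => c * ln r))//.
- apply: ge0_le_integral_subset => //=.
  + by move=> r /=; rewrite !in_itv/= => /andP[->].
  + move=> r /=; rewrite in_itv/= lee_fin => /andP[ar _].
    by rewrite divr_ge0 ?ltW//; exact: lt_le_trans ar.
  + move=> r /=; rewrite in_itv/= lee_fin andbT => ar.
    by rewrite divr_ge0 ?ltW//; exact: lt_le_trans ar.
- apply: continuous_in_subspaceT => r; rewrite inE/= in_itv/= => /andP[ar _].
  apply: cvgM; first exact: cvg_cst.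
  by apply: cvgV => //; rewrite gt_eqF//; exact: lt_le_trans ar.
- have dln r : 0 < r -> derivable (fun r => c * ln r) r 1.
    by move=> r0; apply: derivableM => //; apply: ex_derive; exact: is_derive1_ln.
  have cln r : 0 < r -> {for r, continuous (fun r : R => c * ln r)}.
    by move=> r0; apply: differentiable_continuous; exact/derivable1_diffP/dln.
  split.
  + move=> r; rewrite in_itv/= => /andP[ar _]; apply: dln; exact: lt_trans ar.
  + by apply: cvg_at_right_filter; exact: cln.
  + by apply: cvg_at_left_filter; apply: cln; exact: lt_trans ab.
- move=> r; rewrite in_itv/= => /andP[ar _].
  have r0 : 0 < r by exact: lt_trans ar.
  rewrite derive1E deriveZ/=; last by apply: ex_derive; exact: is_derive1_ln.
  by have [_ ->] := is_derive1_ln r0.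
Qed.

(** * The beta function for parameters above 1 *)

Section beta_integrand.
Variable R : realType.
Implicit Types a b v : R.

(** Exponents are shifted by one: [beta_real a b] integrates [beta_kernel (a - 1) (b - 1)], so
    parameters above 1 there are positive exponents here. *)
Definition beta_kernel a b v : R := v `^ a * (1 - v) `^ b.

Lemma is_derive_powR_onem b v : v < 1 ->
  is_derive v 1 (fun t : R => (1 - t) `^ b) (b * (1 - v) `^ (b - 1) * -1).
Proof.
move=> v1; have w0 : 0 < 1 - v by rewrite subr_gt0.
have dw := is_derive1_powR b w0.
have d1 : is_derive v 1 (fun t : R => 1 - t) (-1).
  by apply: is_derive_eq; rewrite add0r mul1r.
have h := (@is_derive1_comp _ (fun x => powR x b) (fun t : R => 1 - t) v _ _ dw d1).
exact: h.
Qed.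

Lemma is_derive_beta_kernel a b v : 0 < v -> v < 1 ->
  is_derive v 1 (beta_kernel a b)
    (a * beta_kernel (a - 1) b v - b * beta_kernel a (b - 1) v).
Proof.
move=> v0 v1; have dl := is_derive1_powR a v0.
have dr := is_derive_powR_onem b v1.
by apply: (is_derive_eq (is_deriveM dl dr)); rewrite /beta_kernel /GRing.scale/=; ring.
Qed.

(** With positive exponents the kernel tends to 0 at both ends, which is also its value there. *)
Lemma beta_kernel_derivable a b : 0 < a -> 0 < b ->
  derivable_oo_LRcontinuous (beta_kernel a b) 0 1.
Proof.
move=> a0 b0; split.
- move=> v; rewrite in_itv/= => /andP[v0 v1].
  by apply: ex_derive; exact: is_derive_beta_kernel.
- rewrite /beta_kernel powR0 ?gt_eqF// mul0r.
  rewrite -[X in _ --> X](mul0r ((1 - 0) `^ b)); apply: cvgM; first exact: powR_cvg0.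
  have : {for 0, continuous (fun t : R => (1 - t) `^ b)}.
    apply: differentiable_continuous; apply/derivable1_diffP; apply: ex_derive.
    exact: is_derive_powR_onem.
  exact: cvg_at_right_filter.
- rewrite /beta_kernel subrr [0 `^ b]powR0 ?gt_eqF// mulr0.
  rewrite -[X in _ --> X](mulr0 (1 `^ a)); apply: cvgM.
    have : {for 1, continuous (fun t : R => t `^ a)}.
      apply: differentiable_continuous; apply/derivable1_diffP; apply: ex_derive.
      exact: is_derive1_powR.
    exact: cvg_at_left_filter.
  (* The reflection [1 - v] reduces the limit at 1 from the left to that of a power at 0 from the
     right. *)
  have c1 : (1 - v) @[v --> (1 : R)^'-] --> (0 : R)^'+.
    move=> A [e e0 eA]; exists e => // v /= ve v1; apply: eA; last by rewrite subr_gt0.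
    by rewrite /= sub0r normrN.
  exact: cvg_comp c1 (powR_cvg0 b0).
Qed.

Lemma continuous_beta_kernel a b : 0 < a -> 0 < b ->
  {within `[0, 1], continuous (beta_kernel a b)}.
Proof.
by move=> a0 b0; apply: derivable_oo_LRcontinuous_within; exact: beta_kernel_derivable.
Qed.

Lemma integrable_beta_kernel a b : 0 < a -> 0 < b ->
  (@lebesgue_measure R).-integrable `]0, 1[ (EFin \o beta_kernel a b).
Proof.
move=> a0 b0; have cI : (@lebesgue_measure R).-integrable `[0, 1] (EFin \o beta_kernel a b).
  apply: continuous_compact_integrable; first exact: segment_compact.
  exact: continuous_beta_kernel.
apply: integrableS cI => //; exact: subset_itv_oo_cc.
Qed.

Lemma integrableZ_beta_kernel c a b : 0 < a -> 0 < b ->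
  (@lebesgue_measure R).-integrable `]0, 1[
    (EFin \o (fun v => c * beta_kernel a b v)).
Proof.
move=> a0 b0.
exact: (integrableZl _ c (integrable_beta_kernel a0 b0)).
Qed.

(** The integrand is split by [1 = v + (1 - v)]. *)
Lemma beta_real_add a b : 1 < a -> 1 < b ->
  beta_real a b = beta_real (a + 1) b + beta_real a (b + 1).
Proof.
move=> a1 b1; rewrite /beta_real -RintegralD//; last 2 first.
- by apply: integrable_beta_kernel; lra.
- by apply: integrable_beta_kernel; lra.
apply: eq_Rintegral => v; rewrite inE/= in_itv/= => /andP[v0 v1].
have v_neq0 : v != 0 by rewrite gt_eqF.
have w_neq0 : 1 - v != 0 by rewrite gt_eqF// subr_gt0.
rewrite ![_ + 1 - 1]addrAC !powRD ?v_neq0 ?w_neq0 ?implybT//.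
by rewrite !powRr1 ?subr_ge0 ?ltW//; ring.
Qed.

(* The derivative of v^a (1 - v)^b integrates to 0 over [0, 1]. *)
Lemma beta_real_parts a b : 1 < a -> 1 < b ->
  b * beta_real (a + 1) b = a * beta_real a (b + 1).
Proof.
move=> a1 b1.
have a0 : 0 < a by lra. have b0 : 0 < b by lra.
pose F' v := a * beta_kernel (a - 1) b v - b * beta_kernel a (b - 1) v.
have Ia : (@lebesgue_measure R).-integrable `]0, 1[
    (EFin \o (fun v => a * beta_kernel (a - 1) b v)).
  by apply: integrableZ_beta_kernel; lra.
have Ib : (@lebesgue_measure R).-integrable `]0, 1[
    (EFin \o (fun v => b * beta_kernel a (b - 1) v)).
  by apply: integrableZ_beta_kernel; lra.
have F'E : \int[@lebesgue_measure R]_(v in `]0, 1[) F' v =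
    a * beta_real a (b + 1) - b * beta_real (a + 1) b.
  rewrite /beta_real !addrK -!RintegralZl//; last 2 first.
  - by apply: integrable_beta_kernel; lra.
  - by apply: integrable_beta_kernel; lra.
  by rewrite -RintegralB.
apply/esym/subr0_eq; rewrite -F'E.
have cF' : {within `[0, 1], continuous F'}.
  move=> v; apply: cvgB; apply: cvgM; try exact: cvg_cst.
  - by apply: continuous_beta_kernel; lra.
  - by apply: continuous_beta_kernel; lra.
(* Adding the negligible endpoints gives the closed interval on which the fundamental theorem is
   applied. *)
rewrite /Rintegral -(@integral_itv_bndoo _ _ _ _ true false); last first.
  exact: (measurable_int _ (integrableB _ Ia Ib)).
rewrite (@continuous_FTC2 _ F' (beta_kernel a b))//.
- by rewrite /= /beta_kernel /= (subrr 1) !powR0 ?gt_eqF// mul0r mulr0 subrr.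
- exact: beta_kernel_derivable.
- move=> v; rewrite in_itv/= => /andP[v0 v1]; rewrite derive1E.
  by have [_ ->] := is_derive_beta_kernel a b v0 v1.
Qed.

(** On [[1/3, 2/3]] both [v] and [1 - v] are at least 1/3, so the integrand is at least [c]
    there. *)
Lemma beta_real_gt0 a b : 1 < a -> 1 < b -> 0 < beta_real a b.
Proof.
move=> a1 b1.
have a0 : 0 < a - 1 by lra. have b0 : 0 < b - 1 by lra.
pose c : R := (1 / 3) `^ (a - 1) * (1 / 3) `^ (b - 1).
have c0 : 0 < c by rewrite mulr_gt0// powR_gt0//; lra.
apply: (@lt_le_trans _ _ (\int[@lebesgue_measure R]_(v in `[(1 / 3), (2 / 3)]) c)).
  rewrite Rintegral_cst//= lebesgue_measure_itv/= lte_fin.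
  by rewrite ifT ?mulr_gt0//=; lra.
rewrite -lee_fin /beta_real /Rintegral !fineK//; last 2 first.
- by apply: integrable_fin_num => //; exact: integrable_beta_kernel.
- rewrite integral_cst//= lebesgue_measure_itv/= lte_fin ifT//; lra.
apply: ge0_le_integral_subset => //=.
- by move=> v /=; rewrite !in_itv/= => /andP[v0 v1]; apply/andP; split; lra.
- by move=> v _; rewrite lee_fin ltW.
- by move=> v _; rewrite lee_fin mulr_ge0 ?powR_ge0.
- move=> v /=; rewrite in_itv/= lee_fin => /andP[v0 v1].
  by apply: ler_pM; rewrite ?powR_ge0//; apply: ge0_ler_powR; rewrite ?nnegrE; lra.
Qed.

(** Solves the two linear relations [beta_real_add] and [beta_real_parts]; [beta_real_succr] does
    the same for the other unknown. *)
Lemma beta_real_succl a b : 1 < a -> 1 < b ->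
  beta_real (a + 1) b = a / (a + b) * beta_real a b.
Proof.
move=> a1 b1; have := beta_real_parts a1 b1; have := beta_real_add a1 b1.
move=> -> h; have ab : a + b != 0 by rewrite gt_eqF//; lra.
apply: (mulfI ab); rewrite mulrA [_ * (a / _)]mulrC divfK// mulrDl h; ring.
Qed.

Lemma beta_real_succr a b : 1 < a -> 1 < b ->
  beta_real a (b + 1) = b / (a + b) * beta_real a b.
Proof.
move=> a1 b1; have := beta_real_parts a1 b1; have := beta_real_add a1 b1.
move=> -> h; have ab : a + b != 0 by rewrite gt_eqF//; lra.
apply: (mulfI ab); rewrite mulrA [_ * (b / _)]mulrC divfK// mulrDr h; ring.
Qed.

(** Each of the [y + z] unit shifts contributes a factor whose numerator is at least [a] or [b] and
    whose denominator is at most [t]. The shifts of [b] come first, in the base case of the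
    induction on [y]. *)
Lemma beta_real_shift_ge a b t (y z : nat) : 1 < a -> 1 < b ->
  a + b + (y + z)%:R <= t ->
  (a / t) ^+ y * (b / t) ^+ z * beta_real a b <= beta_real (y%:R + a) (z%:R + b).
Proof.
move=> a1 b1; have y0 k : 0 <= k%:R :> R by exact: ler0n.
have B0 := ltW (beta_real_gt0 a1 b1).
have frac u s : 1 < u -> u <= s -> 0 <= u / s :> R.
  by move=> u1 us; apply: divr_ge0; lra.
elim: y => [|y IH]; rewrite ?add0n.
  rewrite expr0 mul1r add0r; elim: z => [|z IH] zt.
    by rewrite expr0 mul1r add0r.
  have /IH{}IH : a + b + z%:R <= t by move: zt; rewrite -natr1; lra.
  rewrite -natr1 addrAC beta_real_succr//; last by have := y0 z; lra.
  rewrite exprS -mulrA; have z0 := y0 z; move: zt; rewrite -natr1 => zt.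
  apply: ler_pM => //; first by apply: frac; lra.
    by rewrite mulr_ge0 ?exprn_ge0 ?divr_ge0//; lra.
  by apply: ler_pM; rewrite ?lef_pV2 ?posrE ?invr_ge0//; lra.
rewrite addSn -natr1 natrD => yt.
have /IH{}IH : a + b + (y + z)%:R <= t by rewrite natrD; lra.
have z0 := y0 z; have {}y0 := y0 y.
rewrite -natr1 addrAC beta_real_succl//; [|lra..].
rewrite exprS -2!mulrA; apply: ler_pM.
- by apply: frac; lra.
- by rewrite !mulr_ge0 ?exprn_ge0 ?divr_ge0//; lra.
- by apply: ler_pM; rewrite ?lef_pV2 ?posrE ?invr_ge0//; lra.
- by rewrite mulrA.
Qed.

End beta_integrand.

(** * A lower bound on the likelihood for large [r] *)

(** Apply [beta_real_shift_ge] with [t = r + n] and bound the binomial coefficient below by 1. The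
    resulting bound is free of [r]. *)
Lemma beta_binomial_ge (R : realType) (n y : nat) (r p : R) :
  (y <= n)%N -> 0 < p < 1 -> 1 < r * p -> 1 < r * (1 - p) ->
  (p / n.+1%:R) ^+ y * ((1 - p) / n.+1%:R) ^+ (n - y) <=
  'C(n, y)%:R * (beta_real (y%:R + r * p) (n%:R - y%:R + r * (1 - p)) /
                 beta_real (r * p) (r * (1 - p))).
Proof.
move=> yn /andP[p0 p1] rp rq; have B0 := beta_real_gt0 rp rq.
have n0 : 0 <= n%:R :> R by exact: ler0n.
have n1 : 0 < n.+1%:R :> R by exact: ltr0n.
have r1 : 1 < r by nra.
have C1 : 1 <= 'C(n, y)%:R :> R by rewrite ler1n bin_gt0.
rewrite -natrB// mulrA ler_pdivlMr//.
(* This removes [r]: [r / (r + n) >= 1 / (n + 1)] because [r > 1]. *)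
have frac u : 0 < u -> u / n.+1%:R <= r * u / (r + n%:R).
  move=> u0; rewrite ler_pdivlMr; last by lra.
  rewrite mulrAC ler_pdivrMr// -natr1 -subr_ge0.
  rewrite (_ : _ - _ = u * n%:R * (r - 1)); last by ring.
  by rewrite !mulr_ge0// ?subr_ge0 ltW.
have := @beta_real_shift_ge _ _ _ (r + n%:R) y (n - y) rp rq.
rewrite subnKC// (_ : r * p + r * (1 - p) = r); last by ring.
move=> /(_ (lexx _)) B1; apply: le_trans (le_trans _ B1) _.
  apply: ler_wpM2r; first exact: ltW.
  have fracX u i : 0 < u -> (u / n.+1%:R) ^+ i <= (r * u / (r + n%:R)) ^+ i.
    by move=> u0; apply: lerXn2r; rewrite ?nnegrE ?frac// divr_ge0//; nra.
  have frac0 u i : 0 < u -> 0 <= (u / n.+1%:R) ^+ i.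
    by move=> u0; rewrite exprn_ge0// divr_ge0// ltW.
  by apply: ler_pM; rewrite ?frac0 ?fracX ?subr_gt0.
apply: ler_peMl => //; apply: le_trans B1; rewrite !mulr_ge0 ?exprn_ge0 ?divr_ge0//; lra.
Qed.

Lemma likelihood_bounded_below (R : realType) (k m : nat) (n y : 'I_k -> nat)
    (x : 'I_k -> 'cV[R]_m) (b : 'cV[R]_m) : (forall j, (y j <= n j)%N) ->
  exists r0 c : R,
    [/\ 0 < r0, 0 < c & forall r, r0 <= r -> c <= likelihood n y x r b].
Proof.
move=> yn; pose p j := success_prob (x j) b.
have p0 j : 0 < p j by case/andP: (success_prob_itv (x j) b).
have q0 j : 0 < 1 - p j by rewrite subr_gt0; case/andP: (success_prob_itv (x j) b).
have t0 j : 0 < (p j)^-1 + (1 - p j)^-1 by rewrite addr_gt0 ?invr_gt0.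
(* A sum in place of a maximum: it dominates the reciprocals of every group at once. *)
pose s := \sum_(j < k) ((p j)^-1 + (1 - p j)^-1).
have s0 : 0 <= s by apply: sumr_ge0 => j _; exact: ltW.
have sj j : (p j)^-1 + (1 - p j)^-1 <= s.
  by rewrite /s (bigD1 j)//= lerDl; apply: sumr_ge0 => i _; exact: ltW.
pose c j := (p j / (n j).+1%:R) ^+ y j * ((1 - p j) / (n j).+1%:R) ^+ (n j - y j).
have c0 j : 0 < c j by rewrite mulr_gt0// exprn_gt0// divr_gt0.
(* Beyond [1 + s] both [r * p j] and [r * (1 - p j)] exceed 1. *)
exists (1 + s), (\prod_(j < k) c j); split; first lra.
  by apply: prodr_gt0 => j _.
move=> r rs; apply: ler_prod => j _; rewrite ltW//=.
apply: beta_binomial_ge; rewrite ?success_prob_itv//.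
  rewrite -ltr_pdivrMr// mul1r; have := sj j.
  have : 0 < (1 - p j)^-1 by rewrite invr_gt0.
  by rewrite -/(p j); lra.
rewrite -ltr_pdivrMr// mul1r; have := sj j.
have : 0 < (p j)^-1 by rewrite invr_gt0.
by rewrite -/(p j); lra.
Qed.

(** Also covers small [r], where [r * p] drops below 1 and [beta_real_gt0] does not apply. *)
Lemma beta_real_ge0 (R : realType) (a b : R) : 0 <= beta_real a b.
Proof. by apply: Rintegral_ge0 => v _; rewrite mulr_ge0 ?powR_ge0. Qed.

Lemma likelihood_ge0 (R : realType) (k m : nat) (n y : 'I_k -> nat)
    (x : 'I_k -> 'cV[R]_m) (r : R) (b : 'cV[R]_m) : 0 <= likelihood n y x r b.
Proof.
by apply: prodr_ge0 => j _; rewrite mulr_ge0// divr_ge0 ?beta_real_ge0.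
Qed.

(** * Divergence of the posterior mass *)

Theorem mainTheorem7 (R : realType) (k m : nat)
    (m_ge1 : (1 <= m)%N) (k_gem : (m <= k)%N)
    (n y : 'I_k -> nat) (x : 'I_k -> 'cV[R]_m)
    (n_ge1 : forall j, (1 <= n j)%N) (y_len : forall j, (y j <= n j)%N)
    (f : R -> R) (g : 'cV[R]_m -> R)
    (f_prior : proportional_on `]0, +oo[ f (fun r => r^-1))
    (g_prior : proportional_on setT g (fun=> 1) \/ is_gaussian_density g) :
  improper_posterior f g n y x.
Proof.
(* Both kinds of prior are reduced to pointwise positivity of [g]. *)
have g0 b : 0 < g b.
  case: g_prior => [[c c0 gE]|]; last exact: gaussian_density_gt0.
  by rewrite gE// mulr1.
have [c c0 fE] := f_prior.
rewrite /improper_posterior /posterior_mass /=.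
(* Once the inner integral is [+oo] at every point, the outer one is [+oo] times a positive
   measure. *)
rewrite (eq_integral (cst +oo%E)) => [|t _].
  by rewrite integral_cst// gt0_mulye// lebesgue_tuple_setT_gt0.
set b := \col_i tnth t i; have [r0 [l [r00 l0 lP]]] := likelihood_bounded_below x b y_len.
(* The constant collects [c] from [f r = c / r], the prior value [g b] and the likelihood bound [l]
   on [[r0, +oo[]. *)
apply/eqP; rewrite -leye_eq -(@integral_inv_pinfty _ r0 (c * g b * l))//; last first.
  by rewrite !mulr_gt0.
apply: ge0_le_integral_subset.
- by move=> r /=; rewrite !in_itv/= !andbT; exact: lt_le_trans.
- move=> r /=; rewrite in_itv/= andbT => r0r; have r_gt0 := lt_le_trans r00 r0r.
  by rewrite lee_fin divr_ge0 ?mulr_ge0 ?ltW.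
- move=> r /[dup] /fE ->; rewrite /= in_itv/= andbT => r_gt0.
  by rewrite lee_fin !mulr_ge0 ?likelihood_ge0 ?invr_ge0 ?ltW.
- move=> r /=; rewrite in_itv/= andbT => r0r; have r_gt0 := lt_le_trans r00 r0r.
  rewrite lee_fin fE/= ?in_itv/= ?r_gt0//.
  rewrite (_ : _ / r = c / r * g b * l); last by ring.
  by apply: ler_wpM2l (lP _ r0r); rewrite !mulr_ge0 ?invr_ge0 ?ltW.
Qed.
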